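(* Let $d\ge 3$ and $n\ge 1$ be integers, and let $\delta_N$ be any polyhedral distance function in $\mathbb{R}^d$ for which the polyhedron $P_N$ has at least $2\log_2 n$ facets. Then every $n$-vertex graph $G$ has a $\delta_N$-obstacle representation.
   Context: Graphs are finite, simple and undirected. For a finite set $N=\{v_0,\dots,v_{t-1}\}$ of vectors in $\mathbb{R}^d$, the polyhedral distance function $\delta_N$ is $$\delta_N(p,q)=\min\Big\{\sum_{i=0}^{t-1}|a_i| : \pi(q-p)=\sum_{i=0}^{t-1}a_iv_i\Big\},$$ where $\pi$ is the orthogonal projection onto the linear span of $N$. It determines the centrally symmetric polyhedron $P_N=\{x\in\mathbb{R}^d:\delta_N(\mathbf{0},x)\le 1\}$. For a (closed) facet $F$ of $P_N$, the cone $C_F$ is the union of all rays that start at the origin and contain a point of $F$, and for $x\in\mathbb{R}^d$ the $F$-sector of $x$ is $Q^N_F(x)=C_F+x$. A curve is a continuous map $f:[0,1]\to\mathbb{R}^d$ with endpoints $f(0),f(1)$ and image $f([0,1])$. A curve $f$ is $\delta_N$-monotone if there is a facet $F$ of $P_N$ such that $f(b)\in Q^N_F(f(a))$ for all $0\le a\le b\le 1$. The geodesics for $\delta_N$ are the $\delta_N$-monotone curves. A $\delta_N$-obstacle representation of a graph $G$ is a pair $(\varphi,S)$, where $\varphi:V(G)\to\mathbb{R}^d$ is injective and $S$ is a set of connected subsets of $\mathbb{R}^d$ (obstacles), such that for all distinct $u,w\in V(G)$: $uw\in E(G)$ if and only if there is a geodesic for $\delta_N$ with endpoints $\varphi(u)$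 and $\varphi(w)$ whose image is disjoint from $\bigcup S$. *)

(* Defs.v *)
From mathcomp Require Import all_boot all_order all_algebra finmap.
From mathcomp Require Import all_classical all_reals all_analysis.

Set Implicit Arguments.
Unset Strict Implicit.
Unset Printing Implicit Defensive.

Import Order.TTheory GRing.Theory Num.Theory numFieldNormedType.Exports.

Local Open Scope classical_set_scope.
Local Open Scope ring_scope.

Section Defs.
Context {R : realType} {d : nat}.
Local Notation E := 'rV[R]_d.
Implicit Types (N : {fset E}) (A P F : set E).

Definition dotv (x y : E) : R := (x *m y^T) 0 0.

Definition fset_mx N : 'M[R]_(#|` N|, d) := \matrix_(i < #|` N|) N`_i.

(* The linear projection onto the row space of [fset_mx N], i.e. onto span N,
   along [kermx (fset_mx N)^T], i.e. along the orthogonal complement of N;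
   see [orthproj_span] and [orthprojP]. *)
Definition orthproj N (x : E) : E :=
  x *m proj_mx (genmx (fset_mx N)) (kermx (fset_mx N)^T).

Definition log2 (x : R) : R := ln x / ln 2.

(* The infimum is a minimum; see [polydist_min]. *)
Definition polydist N (p q : E) : R :=
  inf [set \sum_(v <- N) `|a v| | a in
        [set a : E -> R | orthproj N (q - p) = \sum_(v <- N) a v *: v]].

Definition polyhedron N : set E := [set x | polydist N 0 x <= 1].

(* c = 0 is allowed: P and the empty set are faces; the dimension condition in
   [facets] excludes them there. *)
Definition is_face P F : Prop := exists (c : E) (b : R),
  (forall x, P x -> dotv c x <= b) /\ F = P `&` [set x | dotv c x = b].

(* x0 + U is the affine hull of A, since U is the span of all x - x0, x in A. *)
Definition has_affine_dim A (k : nat) : Prop :=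
  exists (x0 : E) (U : {vspace E}),
    [/\ A x0,
        forall x, A x -> x - x0 \in U,
        forall W : {vspace E}, (forall x, A x -> x - x0 \in W) -> (U <= W)%VS
      & \dim U = k].

Definition facets P : set (set E) :=
  [set F | is_face P F /\
           exists k, has_affine_dim P k.+1 /\ has_affine_dim F k].

Definition ray (u : E) : set E := [set t *: u | t in [set t : R | 0 <= t]].

Definition cone F : set E :=
  \bigcup_(u in [set u | u != 0 /\ ray u `&` F !=set0]) ray u.

Definition sector F (x : E) : set E := [set y + x | y in cone F].

Definition curve (f : R -> E) : Prop := {within `[0, 1], continuous f}.

Definition monotone N (f : R -> E) : Prop :=
  exists2 F, facets (polyhedron N) F &
    forall a b, 0 <= a -> a <= b -> b <= 1 -> sector F (f a) (f b).

Definition geodesic N (f : R -> E) : Prop := curve f /\ monotone N f.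

Definition obstacle_representation (V : finType) (e : rel V) N
    (phi : V -> E) (S : set (set E)) : Prop :=
  [/\ injective phi,
      forall O, S O -> connected O
    & forall u w, u != w ->
        e u w <->
        exists2 f, geodesic N f &
          [/\ f 0 = phi u, f 1 = phi w
            & f @` `[0, 1] `&` \bigcup_(O in S) O = set0]].

Lemma orthproj_span N x : (orthproj N x <= fset_mx N)%MS.
Proof. by rewrite /orthproj (submx_trans (proj_mx_sub _ _ _))// genmxE. Qed.

Lemma dotv_gt0 (x : E) : x != 0 -> 0 < dotv x x.
Proof.
move=> x0; rewrite lt_neqAle /dotv mxE; apply/andP; split; last first.
  by apply: sumr_ge0 => i _; rewrite mxE -expr2 sqr_ge0.
rewrite eq_sym psumr_eq0; last by move=> i _; rewrite mxE -expr2 sqr_ge0.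
apply: contra x0 => /allP x0; apply/eqP/rowP => i; rewrite mxE.
by have := x0 i (mem_index_enum i); rewrite mxE -expr2 sqrf_eq0 => /eqP.
Qed.

Lemma orthprojP N x v : v \in N -> dotv (x - orthproj N x) v = 0.
Proof.
set M := fset_mx N; move=> vN.
have cap0 : (genmx M :&: kermx M^T = 0)%MS.
  apply/eqP/rowV0P => y; rewrite sub_capmx genmxE => /andP[/submxP[z yz]].
  move=> /sub_kermxP yk; apply/eqP; apply: contraT => /dotv_gt0.
  by rewrite /dotv {2}yz trmx_mul mulmxA yk mul0mx mxE ltxx.
have full : (x <= genmx M + kermx M^T)%MS.
  apply: submx_full; rewrite /row_full eqn_leq rank_leq_col /=.
  have /= := mxrank_sum_cap (genmx M) (kermx M^T).
  rewrite cap0 mxrank0 addn0 => ->; rewrite genmxE mxrank_ker mxrank_tr.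
  by rewrite subnKC // rank_leq_col.
have xE : x - orthproj N x = x *m proj_mx (kermx M^T) (genmx M).
  by apply/eqP; rewrite subr_eq addrC (add_proj_mx cap0 full).
have /sub_kermxP : (x - orthproj N x <= kermx M^T)%MS by rewrite xE proj_mx_sub.
have iN : (index v N < #|` N|)%N by rewrite cardfE cardE -cardE -cardfE index_mem.
move=> /(congr1 (fun B : 'rV_ _ => B 0 (Ordinal iN))).
rewrite mxE [RHS]mxE => H; rewrite /dotv mxE -[RHS]H.
by apply: eq_bigr => j _; rewrite !mxE /= nth_index.
Qed.

Lemma big_fset_mx (T : nmodType) N (g : E -> T) :
  \sum_(v <- N) g v = \sum_(i < #|` N|) g N`_i.
Proof. by rewrite (big_nth 0) big_mkord cardfE cardE -cardE -cardfE. Qed.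

Lemma mulmx_fset_mx N (c : 'rV[R]_#|` N|) :
  c *m fset_mx N = \sum_i c 0 i *: N`_i.
Proof. by rewrite mulmx_sum_row; apply: eq_bigr => i _; rewrite rowK. Qed.

Lemma polydist_min N p q :
  exists a : E -> R, [/\ orthproj N (q - p) = \sum_(v <- N) a v *: v,
      polydist N p q = \sum_(v <- N) `|a v|
    & forall a' : E -> R, orthproj N (q - p) = \sum_(v <- N) a' v *: v ->
        \sum_(v <- N) `|a v| <= \sum_(v <- N) `|a' v| ].
Proof.
set z := orthproj N (q - p); set t := #|` N|.
pose f (c : 'rV[R]_t) : R := \sum_i `|c 0 i|.
have cf : continuous f.
  apply: continuous_big => [|i _ c]; first exact: add_continuous.
  by apply: (@cvg_norm _ _ _ (nbhs c)); exact: (@coord_continuous R 1 t 0 i c).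
have /submxP[c0 zc0] : (z <= fset_mx N)%MS by exact: orthproj_span.
pose K := [set c | z = c *m fset_mx N] `&` [set c | f c <= f c0].
have K0 : K !=set0 by exists c0; split => /=.
have Kc : compact K.
  have KE : K = (\bigcap_(j : 'I_d) [set c | (c *m fset_mx N) 0 j = z 0 j])
                `&` [set c | f c <= f c0].
    apply/seteqP; split=> c [/= H1 H2]; split=> //.
      by move=> j _ /=; rewrite H1.
    by apply/rowP => j; rewrite -H1.
  have gc j : continuous (fun c : 'rV[R]_t => (c *m fset_mx N) 0 j).
    under eq_fun do rewrite mxE.
    apply: continuous_big => [|i _ c]; first exact: add_continuous.
    by apply: (@cvgMr_tmp _ _ (nbhs c)); exact: (@coord_continuous R 1 t 0 i c).
  have clK : closed K.
    rewrite KE; apply: closedI.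
      apply: closed_bigI => j _.
      by have /continuous_closedP/(_ _ (@closed_eq R (z 0 j))) := gc j.
    by have /continuous_closedP/(_ _ (@closed_le R (f c0))) := cf.
  have box : compact [set v : 'rV[R]_t |
      forall i, v ord0 i \in `[(- f c0), (f c0)]].
    apply: (@rV_compact _ _ (fun=> `[(- f c0), (f c0)]%classic)) => _.
    exact: segment_compact.
  apply: (subclosed_compact clK box).
  move=> c [_ /= cc0] i; rewrite /= in_itv /= -ler_norml (le_trans _ cc0)//.
  by rewrite /f (bigD1 i)//= lerDl sumr_ge0.
have [c /set_mem[/= zc cc0] cmin] := EVT_min_rV K0 Kc (continuous_subspaceT cf).
have fmin c' : z = c' *m fset_mx N -> f c <= f c'.
  move=> zc'; have [le|/ltW gt] := leP (f c') (f c0).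
    by apply: cmin; rewrite inE; split.
  exact: le_trans cc0 gt.
pose co (a : E -> R) : 'rV[R]_t := \row_i a N`_i.
have coz a : \sum_(v <- N) a v *: v = co a *m fset_mx N.
  by rewrite mulmx_fset_mx big_fset_mx; apply: eq_bigr => i _; rewrite mxE.
have cof a : \sum_(v <- N) `|a v| = f (co a).
  by rewrite big_fset_mx; apply: eq_bigr => i _; rewrite mxE.
pose a v := if insub (index v N) is Some i then c 0 i else 0.
have coa : co a = c.
  apply/rowP => i; rewrite mxE /a index_uniq ?fset_uniq//.
  by rewrite valK.
exists a; rewrite coz cof coa; split=> //.
  apply/eqP; rewrite eq_le; apply/andP; split.
    apply: ge_inf; last by exists a; rewrite /= ?coz ?cof coa.
    by exists 0 => _ [a' _ <-]; exact: sumr_ge0.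
  apply: lb_le_inf; first by exists (f c), a; rewrite /= ?coz ?cof coa.
  by move=> _ [a' /= + <-]; rewrite coz cof; exact: fmin.
by move=> a'; rewrite coz cof; exact: fmin.
Qed.

End Defs.

(* Main.v *)
Require Import Defs.
From mathcomp Require Import all_boot all_order all_algebra finmap.
From mathcomp Require Import all_classical all_reals all_analysis.
From mathcomp Require Import polyrcf ring lra zify.

Set Implicit Arguments.
Unset Strict Implicit.
Unset Printing Implicit Defensive.

Import Order.TTheory GRing.Theory Num.Theory numFieldNormedType.Exports.

Local Open Scope classical_set_scope.
Local Open Scope ring_scope.

(** Draw G with straight segments and let the obstacles be the single points off
    the drawing. Pick k facets F_0, ..., F_(k-1) with 2^k >= n, no two of which
    (nor a facet and itself) are antipodal, code the vertices injectively by k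
    bits, and place them so that the direction from u to w lies in the interior
    of the cone of F_i or of -F_i, where i is the top bit at which their codes
    differ and the sign is the value of that bit. Every segment is then a
    geodesic, and no three vertices are in monotone order: both steps would have
    to flip the same bit in the same direction. Since d >= 3 the placement can
    moreover be made generic, so that segments meet only at common endpoints. A
    curve in the drawing between non-adjacent vertices has to pass through a
    third vertex, because its image is connected; so it is not monotone. *)

(** * Facets of the polyhedron and their cones *)

Section Polyhedron.
Context {R : realType} {d : nat}.
Local Notation E := 'rV[R]_d.
Implicit Types (N : {fset E}) (F : set E) (c x y u : E).

Lemma dotvD c x y : dotv c (x + y) = dotv c x + dotv c y.
Proof. by rewrite /dotv linearD mulmxDr mxE. Qed.

Lemma dotvZ c (t : R) x : dotv c (t *: x) = t * dotv c x.
Proof. by rewrite /dotv linearZ -scalemxAr mxE. Qed.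

Lemma dotvN c x : dotv c (- x) = - dotv c x.
Proof. by rewrite -scaleN1r dotvZ mulN1r. Qed.

Lemma dotvNl c x : dotv (- c) x = - dotv c x.
Proof. by rewrite /dotv mulNmx mxE. Qed.

Lemma dotv0 c : dotv c 0 = 0.
Proof. by rewrite -(scale0r (0 : E)) dotvZ mul0r. Qed.

Lemma dotv_sum c (I : finType) (l : I -> R) (y : I -> E) :
  dotv c (\sum_i l i *: y i) = \sum_i l i * dotv c (y i).
Proof.
by rewrite /dotv linear_sum /= mulmx_sumr summxE; apply: eq_bigr => i _;
  rewrite -/(dotv _ _) dotvZ.
Qed.

(** The minimum in [polydist] is attained, so membership is witnessed by one representation, which
    can be negated, scaled and averaged. *)
Lemma polyhedronP N x : polyhedron N x <->
  exists2 a : E -> R, orthproj N x = \sum_(v <- N) a v *: v &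
                      \sum_(v <- N) `|a v| <= 1.
Proof.
have [a [xa Da amin]] := polydist_min N 0 x; rewrite subr0 in xa amin.
rewrite /polyhedron /= Da; split=> [a1|[b xb b1]]; first by exists a.
exact: le_trans (amin b xb) b1.
Qed.

Lemma polyhedronN N x : polyhedron N x -> polyhedron N (- x).
Proof.
move=> /polyhedronP[a xa a1]; apply/polyhedronP; exists (fun v => - a v).
  rewrite /orthproj mulNmx -/(orthproj N x) xa -sumrN.
  by apply: eq_bigr => v _; rewrite scaleNr.
by under eq_bigr do rewrite normrN.
Qed.

Lemma polyhedron_conv N (I : finType) (l : I -> R) (y : I -> E) :
  (forall i, 0 <= l i) -> \sum_i l i <= 1 ->
  (forall i, polyhedron N (y i)) -> polyhedron N (\sum_i l i *: y i).
Proof.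
move=> l0 l1 yP.
have /choice[a Ha] i : exists a : E -> R,
    orthproj N (y i) = \sum_(v <- N) a v *: v /\ \sum_(v <- N) `|a v| <= 1.
  by have /polyhedronP[a] := yP i; exists a.
apply/polyhedronP; exists (fun v => \sum_i l i * a i v).
  rewrite /orthproj mulmx_suml.
  under [RHS]eq_bigr do rewrite scaler_suml.
  rewrite [RHS]exchange_big; apply: eq_bigr => i _.
  rewrite -scalemxAl -/(orthproj N (y i)) (Ha i).1 scaler_sumr.
  by apply: eq_bigr => v _; rewrite scalerA.
apply: le_trans l1.
apply: le_trans (_ : \sum_(v <- N) \sum_i l i * `|a i v| <= _).
  apply: ler_sum => v _; apply: le_trans (ler_norm_sum _ _ _) _.
  by apply: ler_sum => i _; rewrite normrM ger0_norm.
rewrite exchange_big; apply: ler_sum => i _ /=.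
by rewrite -mulr_sumr ler_piMr // (Ha i).2.
Qed.

Lemma polyhedron_absorbing N x : exists2 t : R, 0 < t & polyhedron N (t *: x).
Proof.
have [a [xa _ _]] := polydist_min N 0 x; rewrite subr0 in xa.
pose s := \sum_(v <- N) `|a v|.
have s0 : 0 <= s by apply: sumr_ge0.
(* Dividing by [1 + s] instead of [s] covers the case where all coefficients vanish. *)
have s1 : 0 < 1 + s by rewrite ltr_pwDl.
exists (1 + s)^-1; first by rewrite invr_gt0.
apply/polyhedronP; exists (fun v => (1 + s)^-1 * a v).
  rewrite /orthproj -scalemxAl -/(orthproj N x) xa scaler_sumr.
  by apply: eq_bigr => v _; rewrite scalerA.
under eq_bigr do rewrite normrM ger0_norm ?invr_ge0 ?(ltW s1)//.
by rewrite -mulr_sumr mulrC ler_pdivrMr // mul1r lerDr.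
Qed.

Lemma polyhedron0 N : polyhedron N 0.
Proof.
by have [t _] := polyhedron_absorbing N 0; rewrite scaler0.
Qed.

Lemma dim_rV : dim E = d.
Proof. by rewrite dim_matrix; exact: mul1n. Qed.

(** The polyhedron contains the origin and a positive multiple of every vector, so its direction
    space is everything, even when [N] does not span. *)
Lemma polyhedron_affine_dim N k : has_affine_dim (polyhedron N) k -> k = d.
Proof.
move=> [x0 [U [_ UP _ <-]]].
suff -> : U = fullv by rewrite dimvf dim_rV.
apply/eqP; rewrite eqEsubv subvf /=; apply/subvP => x _.
have x0U : x0 \in U.
  by rewrite -memvN -[- x0]add0r UP//; exact: polyhedron0.
have [t t0 /UP txU] := polyhedron_absorbing N x.
rewrite -[x](scalerK (lt0r_neq0 t0)) memvZ// -(subrK x0 (t *: x)).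
exact: rpredD.
Qed.

(** If [b] were 0, central symmetry would put the whole polyhedron in the supporting hyperplane, and
    [F] would have full dimension. *)
Lemma facet_normal N F : facets (polyhedron N) F -> exists c (b : R),
  [/\ 0 < b, forall x, polyhedron N x -> dotv c x <= b,
      F = polyhedron N `&` [set x | dotv c x = b]
    & exists2 k, d = k.+1 & has_affine_dim F k].
Proof.
move=> [[c [b [cP FE]]] [k [/polyhedron_affine_dim kd Fk]]].
exists c, b; split=> //; last by exists k.
rewrite lt_neqAle; apply/andP; split; last first.
  by rewrite -(dotv0 c); apply: cP; exact: polyhedron0.
apply/eqP => b0; subst b.
have FP : F = polyhedron N.
  rewrite FE; apply/seteqP; split=> [x []//|x Px]; split=> //=.
  apply/eqP; rewrite eq_le cP//= -oppr_le0 -dotvN cP//; exact: polyhedronN.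
move: Fk kd; rewrite FP => /polyhedron_affine_dim -> /eqP.
by rewrite eqn_leq ltnn.
Qed.

Lemma facetN N F :
  facets (polyhedron N) F -> facets (polyhedron N) [set x | F (- x)].
Proof.
move=> [[c [b [cP FE]]] [k [Pk [x0 [U [Fx0 UF Umin Uk]]]]]]; split.
  exists (- c), b; split=> [x Px|].
    by rewrite dotvNl -dotvN; apply: cP; exact: polyhedronN.
  rewrite FE; apply/seteqP; split=> x /= [Px cx]; split.
  - by rewrite -[x]opprK; exact: polyhedronN.
  - by rewrite dotvNl -dotvN.
  - exact: polyhedronN.
  - by rewrite dotvN -dotvNl.
exists k; split=> //; exists (- x0), U; split=> //=; first by rewrite opprK.
  by move=> x /= /UF; rewrite -memvN opprB !opprK addrC.
move=> W WF; apply: Umin => x Fx.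
by have := WF (- x); rewrite /= !opprK -memvN opprD opprK => /(_ Fx).
Qed.

(* F spans the whole space because its affine hull misses the origin. *)
Lemma facet_basis N F : facets (polyhedron N) F ->
  exists X : d.-tuple E, free X /\ forall i, F (tnth X i).
Proof.
move=> /facet_normal[c [b [b0 _ FE [k dk [x0 [U [Fx0 UF Umin Uk]]]]]]].
have cF x : F x -> dotv c x = b by rewrite FE => -[].
pose K : {vspace E} := lker (linfun (mulmxr c^T)).
have memK x : (x \in K) = (dotv c x == 0).
  rewrite memv_ker lfunE /= /dotv -[c *m _]trmxK trmx_mul trmxK mxE.
  by apply/eqP/eqP => [->|H]; [rewrite mxE|apply/rowP => i; rewrite !ord1 H mxE].
have UK : (U <= K)%VS.
  by apply: Umin => x Fx; rewrite memK dotvD dotvN !cF// subrr.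
have x0U : x0 \notin U.
  by apply/negP => /(subvP UK); rewrite memK cF// gt_eqF.
have FX j : (j <= d)%N ->
    exists X : seq E, [/\ size X = j, free X & forall x, x \in X -> F x].
  elim: j => [|j IHj] jd; first by exists [::]; rewrite nil_free.
  have [X [Xj Xfree XF]] := IHj (ltnW jd).
  have [[x Fx xX]|FX] := pselect (exists2 x, F x & x \notin <<X>>%VS).
    exists (x :: X); rewrite free_cons xX Xfree /= Xj; split=> // y.
    by rewrite inE => /predU1P[->//|/XF].
  (* When no point of [F] extends [X], the span of [X] contains [U] and [x0], hence has dimension at
     least [k + 1 = d], although [X] has only [j < d] elements. *)
  have {}FX x : F x -> x \in <<X>>%VS.
    by move=> Fx; apply: contraT => xX; case: FX; exists x.
  have UX : (U <= <<X>>)%VS by apply: Umin => x Fx; rewrite rpredB ?FX.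
  have : (U + <[x0]> <= <<X>>)%VS by rewrite subv_add UX -memvE FX.
  move=> /dimvS; rewrite dimv_disjoint_sum ?dim_vline; last first.
    apply/eqP; rewrite -subv0; apply/subvP => x; rewrite memv_cap => /andP[xU].
    move=> /vlineP[t xt]; rewrite memv0; apply: contraNT x0U => x_neq0.
    have t0 : t != 0 by apply: contraNneq x_neq0 => t0; rewrite xt t0 scale0r.
    by rewrite -(scalerK t0 x0) -xt memvZ.
  have -> : x0 != 0 by apply: contraNneq x0U => ->; exact: mem0v.
  move: Xfree; rewrite /free Xj => /eqP ->.
  by rewrite Uk addn1 -dk leqNgt jd.
have [X [Xd Xfree XF]] := FX d (leqnn d).
exists (tcast Xd (in_tuple X)); rewrite val_tcast; split=> // i.
by have := mem_tnth i (tcast Xd (in_tuple X)); rewrite memtE val_tcast => /XF.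
Qed.

(** For a basis [X] this is the interior of the cone generated by [X]. *)
Definition simplicial_cone (X : d.-tuple E) : set E :=
  [set x | forall i, 0 < coord X i x].

Lemma basis_sum (X : d.-tuple E) x :
  free X -> x = \sum_i coord X i x *: tnth X i.
Proof.
move=> Xfree; rewrite {1}(@coord_span _ _ _ X x).
  by apply: eq_bigr => i _; rewrite (tnth_nth 0).
suff -> : <<X>>%VS = fullv by exact: memvf.
apply/eqP; rewrite eqEdim subvf dimvf dim_rV.
by move: Xfree; rewrite /free size_tuple => /eqP ->; rewrite leqnn.
Qed.

(** Both normals are constant and nonzero on the basis [X], hence proportional, so the two
    supporting hyperplanes coincide. *)
Lemma facet_ext N (X : d.-tuple E) F F' :
  free X -> facets (polyhedron N) F -> facets (polyhedron N) F' ->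
  (forall i, F (tnth X i)) -> (forall i, F' (tnth X i)) -> F' `<=` F.
Proof.
move=> Xfree /facet_normal[c [b [b0 cP FE _]]].
move=> /facet_normal[c' [b' [b'0 c'P F'E _]]] XF XF' x.
rewrite FE F'E => -[Px c'x]; split=> //=.
have cX i : dotv c (tnth X i) = b by have := XF i; rewrite FE => -[].
have c'X i : dotv c' (tnth X i) = b' by have := XF' i; rewrite F'E => -[].
move: c'x; rewrite /= (basis_sum x Xfree) !dotv_sum.
under eq_bigr do rewrite c'X; under [X in _ -> X = _]eq_bigr do rewrite cX.
rewrite -!mulr_suml => /(canRL (mulfK (lt0r_neq0 b'0))) ->.
by rewrite divff ?mul1r ?lt0r_neq0.
Qed.

(** * The open cone over a simplex inside a facet *)

Section Cone.
Variables (N : {fset E}) (F : set E) (X : d.-tuple E).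
Hypotheses (FP : facets (polyhedron N) F) (Xfree : free X)
  (XF : forall i, F (tnth X i)).

Let weight x := \sum_i coord X i x.

Let d_gt0 : (0 < d)%N.
Proof. by have [c [b [_ _ _ [k dk _]]]] := facet_normal FP; rewrite dk. Qed.

Let weight_gt0 x : simplicial_cone X x -> 0 < weight x.
Proof.
move=> Xx; rewrite /weight (bigD1 (Ordinal d_gt0))//= ltr_pwDl// sumr_ge0//.
by move=> i _; exact/ltW.
Qed.

Lemma simplicial_cone_neq0 x : simplicial_cone X x -> x != 0.
Proof.
by move=> /(_ (Ordinal d_gt0)); apply: contraTneq => ->; rewrite linear0 ltxx.
Qed.

(** Dividing by the coordinate sum turns the expansion of [x] in [X] into a convex combination of
    points of [F]. *)
Lemma simplicial_cone_facet x :
  simplicial_cone X x -> F ((weight x)^-1 *: x).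
Proof.
move=> Xx; have w0 := weight_gt0 Xx.
have [c [b [b0 cP FE _]]] := facet_normal FP.
have cX i : dotv c (tnth X i) = b by have := XF i; rewrite FE => -[].
rewrite FE; split; last first.
  rewrite /= dotvZ {2}(basis_sum x Xfree) dotv_sum.
  under eq_bigr do rewrite cX.
  by rewrite -mulr_suml mulrA mulVf ?mul1r ?lt0r_neq0.
rewrite {2}(basis_sum x Xfree) scaler_sumr.
under eq_bigr do rewrite scalerA.
apply: polyhedron_conv => [i||i]; last by have := XF i; rewrite FE => -[].
  by rewrite mulr_ge0 ?invr_ge0 ?ltW.
by rewrite -mulr_sumr mulVf ?lt0r_neq0.
Qed.

(* The point of F on the ray of x is interior to the simplex X, so the functional
   supporting F', maximal there, is constant on X. *)
Lemma simplicial_cone_facet_eq F' x t : facets (polyhedron N) F' ->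
  simplicial_cone X x -> 0 <= t -> F' (t *: x) -> F' = F.
Proof.
move=> F'P Xx t0 F'x; have w0 := weight_gt0 Xx.
have Fx := simplicial_cone_facet Xx.
have [c [b [b0 cP FE _]]] := facet_normal FP.
have [c' [b' [b'0 c'P F'E _]]] := facet_normal F'P.
have [Px cx] : polyhedron N ((weight x)^-1 *: x) /\
  dotv c ((weight x)^-1 *: x) = b by move: Fx; rewrite FE.
have [Ptx c'tx] : polyhedron N (t *: x) /\ dotv c' (t *: x) = b'.
  by move: F'x; rewrite F'E.
have ctx := cP _ Ptx; have c'x := c'P _ Px.
rewrite dotvZ in cx; rewrite dotvZ in ctx; rewrite dotvZ in c'tx.
rewrite dotvZ in c'x.
(* Both multiples of [x] lie on the boundary: [c] bounds [t] from above by the inverse weight, and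
   [c'] bounds it from below. *)
have tw : t <= (weight x)^-1.
  have cx0 : 0 < dotv c x.
    by have := b0; rewrite -cx pmulr_rgt0// invr_gt0.
  by rewrite -(ler_pM2r cx0) cx.
have c'x0 : 0 < dotv c' x.
  move: b'0; rewrite -c'tx; move: (t0); rewrite le0r => /predU1P[->|].
    by rewrite mul0r ltxx.
  by move=> /pmulr_rgt0->.
have wt : (weight x)^-1 <= t.
  by rewrite -(ler_pM2r c'x0) c'tx.
have wx : dotv c' x = weight x * b'.
  by rewrite -c'tx (_ : t = (weight x)^-1) ?mulrA ?mulfV ?mul1r ?lt0r_neq0//;
     apply/eqP; rewrite eq_le tw.
have c'X i : dotv c' (tnth X i) = b'.
  have PX j : polyhedron N (tnth X j) by have := XF j; rewrite FE => -[].
  (* The terms are nonnegative because [c'] is at most [b'] on the polyhedron; as the coefficients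
     are positive, every difference vanishes. *)
  have : \sum_j coord X j x * (b' - dotv c' (tnth X j)) = 0.
    under eq_bigr do rewrite mulrBr.
    rewrite sumrB -mulr_suml -wx {1}(basis_sum x Xfree) dotv_sum.
    by rewrite subrr.
  move=> /eqP; rewrite psumr_eq0 => [/allP/(_ i (mem_index_enum _))|j _].
    by rewrite mulf_eq0 gt_eqF//= subr_eq0 => /eqP.
  by rewrite mulr_ge0 ?subr_ge0 ?c'P// ltW.
have XF' i : F' (tnth X i).
  by rewrite F'E; split=> //=; have := XF i; rewrite FE => -[].
by apply/seteqP; split; exact: (@facet_ext N X).
Qed.

End Cone.
End Polyhedron.

(** * Generic placement of the vertices *)

Section Placement.
Context {R : realType} {d k : nat} {V : finType}.
Local Notation E := 'rV[R]_d.
Variables (code : V -> {ffun 'I_k -> bool}) (f : 'I_k -> E).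

Lemma near_poly_gt0 (p : {poly R}) :
  0 < lead_coef p -> \forall s \near +oo, 0 < p.[s].
Proof.
move=> p0; have [x xp] := poly_pinfty_gt_lc p0.
near=> s; apply: lt_le_trans p0 _; apply: xp.
by near: s; apply: nbhs_pinfty_ge; exact: num_real.
Unshelve. all: by end_near. Qed.

Lemma near_poly_neq0 (p : {poly R}) :
  p != 0 -> \forall s \near +oo, p.[s] != 0.
Proof.
move=> p0; have : 0 < lead_coef (p ^+ 2).
  by rewrite lead_coef_exp exprn_even_gt0 //= lead_coef_eq0.
move=> /near_poly_gt0; apply: filterS => s.
by rewrite horner_exp exprn_even_gt0.
Qed.

Let t (v : V) : R := (enum_rank v)%:R.

Let t_inj : injective t.
Proof.
by move=> u v /eqP; rewrite eqr_nat => /eqP /val_inj /enum_rank_inj.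
Qed.

(* A point of the moment curve plus an [s]-adic expansion: for large [s] the
   top differing code bit of two vertices governs the direction between them. *)
Definition placement (s : R) (v : V) : E :=
  \row_j t v ^+ j.+1 + \sum_i ((code v i)%:R * s ^+ i.+1) *: f i.

(** Along [l] the difference is a polynomial in [s]: the bits above [i] cancel, and bit [i]
    contributes the leading term [l (f i) * s ^+ i.+1]. *)
Lemma near_placement_gt0 (l : {scalar E}) (i : 'I_k) (u w : V) :
  (forall j : 'I_k, (i < j)%N -> code u j = code w j) ->
  code w i -> ~~ code u i -> 0 < l (f i) ->
  \forall s \near +oo, 0 < l (placement s w - placement s u).
Proof.
move=> top wi ui li.
pose a j := ((code w j)%:R - (code u j)%:R) * l (f j).
pose g : E := \row_j t w ^+ j.+1 - \row_j t u ^+ j.+1.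
pose p : {poly R} := (l g)%:P + \sum_j a j *: 'X^(j.+1).
have ai : a i = l (f i) by rewrite /a wi (negbTE ui) subr0 mul1r.
have : 0 < lead_coef p.
  rewrite /p (bigD1 i)//= [a i *: _ + _]addrC addrA lead_coefDr.
    by rewrite lead_coefZ lead_coefXn mulr1 ai.
  rewrite size_scale ?ai ?gt_eqF// size_polyXn ltnS.
  apply: leq_trans (size_polyD _ _) _; rewrite geq_max.
  rewrite (leq_trans (size_polyC_leq1 _))//=.
  apply: leq_trans (size_sum _ _ _) _; apply/bigmax_leqP => j ji.
  have [ij|jlei] := ltnP i j.
    by rewrite /a top// subrr mul0r scale0r size_poly0.
  apply: leq_trans (size_scale_leq _ _) _; rewrite size_polyXn !ltnS.
  by rewrite ltn_neqAle jlei andbT.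
move=> /near_poly_gt0; apply: filterS => s.
rewrite hornerD hornerC horner_sum.
rewrite /placement opprD addrACA -sumrB [X in _ -> 0 < X]linearD.
rewrite [X in _ -> _ < _ + X]linear_sum /=.
congr (0 < _ + _); apply: eq_bigr => j _.
rewrite hornerZ hornerXn -scalerBl linearZ /= /a; ring.
Qed.

(** Affine independence follows from a determinant polynomial in [s] not vanishing. At [s = 0] it is
    the Vandermonde determinant of distinct parameters, so it is not the zero polynomial and has no
    root for large [s]. *)
Lemma near_placement_affine_free q (p : 'I_q.+1 -> V) :
  (q <= d)%N -> injective p ->
  \forall s \near +oo, forall c : 'I_q.+1 -> R,
    \sum_i c i = 0 -> \sum_i c i *: placement s (p i) = 0 ->
    forall i, c i = 0.
Proof.
move=> qd p_inj.
(* Column 0 of [M] is the constant 1, which encodes the condition on the sum of [c]; column [j > 0]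
   holds coordinate [j - 1] of the placement. *)
pose ex (x : E) (j : 'I_q.+1) : R :=
  if unlift ord0 j is Some j' then x 0 (widen_ord qd j') else 0.
pose M : 'M[{poly R}]_q.+1 := \matrix_(i, j)
  ((t (p i) ^+ j)%:P + \sum_l ((code (p i) l)%:R * ex (f l) j) *: 'X^(l.+1)).
have M0 : \det M != 0.
  suff : (\det M).[0] != 0 by apply: contraNneq => ->; rewrite horner0.
  rewrite -horner_evalE -det_map_mx.
  have -> : map_mx (horner_eval 0) M = (Vandermonde _ (\row_i t (p i)))^T.
    apply/matrixP => i j; rewrite !mxE horner_evalE hornerD hornerC horner_sum.
    by rewrite big1 ?addr0// => l _; rewrite hornerZ hornerXn expr0n mulr0.
  rewrite det_tr det_Vandermonde; apply/prodf_neq0 => i _.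
  apply/prodf_neq0 => j ij; rewrite !mxE subr_eq0.
  by apply: contraTneq ij => /t_inj/p_inj ->; rewrite ltnn.
apply: filterS (near_poly_neq0 M0) => s.
rewrite -horner_evalE -det_map_mx -unitfE -unitmxE => Mu c c0 cp i.
have : (\row_i c i) *m map_mx (horner_eval s) M = 0.
  apply/rowP => j; rewrite !mxE.
  have entry i0 : (map_mx (horner_eval s) M) i0 j =
      if unlift ord0 j is Some j' then placement s (p i0) 0 (widen_ord qd j')
      else 1.
    rewrite !mxE horner_evalE hornerD hornerC horner_sum.
    case: unliftP => [j' ->|->]; last first.
      rewrite expr0 big1 ?addr0// => l _.
      by rewrite /ex unlift_none mulr0 scale0r horner0.
    rewrite /placement !mxE summxE; congr (_ + _); apply: eq_bigr => l _.
    by rewrite /ex liftK hornerZ hornerXn mxE; ring.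
  under eq_bigr do rewrite entry mxE.
  case: unlift => [j'|]; last by under eq_bigr do rewrite mulr1.
  have /(congr1 (fun x : E => x 0 (widen_ord qd j'))) := cp.
  rewrite summxE [RHS]mxE => H; rewrite -[RHS]H.
  by apply: eq_bigr => l _; rewrite [RHS]mxE.
move=> /(congr1 (mulmxr (invmx (map_mx (horner_eval s) M)))) /=.
by rewrite mulmxK// mul0mx => /rowP/(_ i); rewrite !mxE.
Qed.

End Placement.

(** * Straight-line drawings *)

Section SegmentDrawing.
Context {R : realType} {d : nat}.
Local Notation E := 'rV[R]_d.

Definition segment (a b : E) : set E :=
  [set a + t *: (b - a) | t in `[0, 1]%classic].

Lemma segment_map_continuous (a b : E) :
  continuous (fun t : R => a + t *: (b - a)).
Proof.
move=> t; apply: cvgD; first exact: cvg_cst.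
exact: (@cvgZr_tmp _ _ _ (nbhs t)).
Qed.

Lemma segment_closed (a b : E) : closed (segment a b).
Proof.
apply: compact_closed; first exact: norm_hausdorff.
apply: continuous_compact; last exact: segment_compact.
by apply: continuous_subspaceT => t; exact: segment_map_continuous.
Qed.

Lemma segment_left (a b : E) : segment a b a.
Proof. by exists 0; rewrite /= ?in_itv/= ?lexx ?ler01// scale0r addr0. Qed.

Lemma segmentC (a b : E) : segment a b `<=` segment b a.
Proof.
move=> _ [t /= /itvP t01 <-]; exists (1 - t).
  by rewrite /= in_itv/= subr_ge0 gerBl !t01.
by apply/rowP => i; rewrite !mxE; ring.
Qed.

Lemma coneP (F : set E) (x : E) : x != 0 ->
  cone F x <-> exists2 t : R, 0 <= t & F (t *: x).
Proof.
move=> x0; split.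
  move=> [u [/= u0 [_ [[t /= t0 <-] Fu]]]] [s /= s0 xE].
  have s_gt0 : 0 < s.
    by rewrite lt_neqAle s0 andbT eq_sym; apply: contraNneq x0 => sE;
      rewrite -xE sE scale0r.
  exists (t / s); first by rewrite divr_ge0.
  by rewrite -xE scalerA divfK// lt0r_neq0.
move=> [t t0 Fx]; exists x; last by exists 1; rewrite /= ?scale1r.
by split=> //; exists (t *: x); split=> //; exists t.
Qed.

Lemma cone_scale (F : set E) (x : E) (t : R) :
  0 <= t -> cone F x -> cone F (t *: x).
Proof.
move=> t0 [u Fu [s /= s0 <-]]; exists u => //; exists (t * s).
  exact: mulr_ge0.
by rewrite scalerA.
Qed.

Lemma sectorE (F : set E) (x y : E) : sector F x y <-> cone F (y - x).
Proof.
split=> [[z Fz <-]|Fyx]; first by rewrite addrK.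
by exists (y - x); rewrite ?subrK.
Qed.

Lemma segment_geodesic (N : {fset E}) (F : set E) (a b : E) :
  facets (polyhedron N) F -> cone F (b - a) ->
  geodesic N (fun t => a + t *: (b - a)).
Proof.
move=> FP Fab; split.
  by apply: continuous_subspaceT => t; exact: segment_map_continuous.
exists F => // s t _ st _; apply/sectorE.
rewrite opprD addrACA subrr add0r -scalerBl.
by apply: cone_scale => //; rewrite subr_ge0.
Qed.

(** A common point with parameters [s] and [t] is an affine dependence among at most four vertices;
    independence kills the coefficient [1 - s] of [phi u]. *)
Lemma affine_free_segmentI (V : finType) (phi : V -> E) :
  (forall q (p : 'I_q.+1 -> V), (q <= 3)%N -> injective p ->
    forall c : 'I_q.+1 -> R,
    \sum_i c i = 0 -> \sum_i c i *: phi (p i) = 0 -> forall i, c i = 0) ->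
  forall u x y z, u != x -> y != z -> y != u -> z != u ->
  segment (phi u) (phi x) `&` segment (phi y) (phi z) `<=` [set phi x].
Proof.
move=> free u x y z ux yz yu zu _ [[s _ <-] [t _ eqp]].
suff -> : s = 1 by rewrite /= scale1r addrC subrK.
have tupleP q (T : q.+1.-tuple V) (c : q.+1.-tuple R) :
    (q <= 3)%N -> uniq T -> \sum_i tnth c i = 0 ->
    \sum_i tnth c i *: phi (tnth T i) = 0 -> forall i, tnth c i = 0.
  move=> q3 /(uniqP u) Tu; apply: (free q (tnth T)) => // i j.
  rewrite !(tnth_nth u) => ij; apply/val_inj/Tu => //;
    by rewrite inE size_tuple ltn_ord.
have eq0 i : (1 - s) * phi u 0 i + s * phi x 0 i - (1 - t) * phi y 0 i
   - t * phi z 0 i = 0.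
  by have /rowP/(_ i) := eqp; rewrite !mxE => H; lra.
(* Coinciding vertices are merged because independence concerns injective families; [u] differs from
   the others and keeps its coefficient. *)
have [xy|xy] := eqVneq x y.
  have := @tupleP 2 [tuple u; x; z] [tuple 1 - s; s - (1 - t); - t] isT.
  rewrite /= !inE !negb_or ux xy yz eq_sym zu /= !big_ord_recl !big_ord0.
  rewrite /tnth /= => H.
  have := H isT _ _ ord0; rewrite /tnth /= => {}H; suff : 1 - s = 0 by lra.
  apply: H; first lra.
  apply/rowP => i; rewrite !mxE; have := eq0 i; rewrite xy; lra.
have [xz|xz] := eqVneq x z.
  have := @tupleP 2 [tuple u; x; y] [tuple 1 - s; s - t; - (1 - t)] isT.
  rewrite /= !inE !negb_or ux xy eq_sym yu /= !big_ord_recl !big_ord0.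
  rewrite /tnth /= => H.
  have := H isT _ _ ord0; rewrite /tnth /= => {}H; suff : 1 - s = 0 by lra.
  apply: H; first lra.
  apply/rowP => i; rewrite !mxE; have := eq0 i; rewrite xz; lra.
have := @tupleP 3 [tuple u; x; y; z] [tuple 1 - s; s; - (1 - t); - t] isT.
rewrite /= !inE !negb_or ux xy xz yz ![u == _]eq_sym yu zu /=.
rewrite !big_ord_recl !big_ord0 /tnth /= => H.
have := H isT _ _ ord0; rewrite /tnth /= => {}H; suff : 1 - s = 0 by lra.
apply: H; first lra.
by apply/rowP => i; rewrite !mxE; have := eq0 i; lra.
Qed.

Lemma segment_obstacle_representation (N : {fset E}) (V : finType)
    (e : rel V) (phi : V -> E) :
  symmetric e -> irreflexive e -> injective phi ->
  (forall u w, u != w ->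
    exists2 F, facets (polyhedron N) F & cone F (phi w - phi u)) ->
  (forall u x w F, u != x -> x != w -> facets (polyhedron N) F ->
    cone F (phi x - phi u) -> cone F (phi w - phi x) -> False) ->
  (forall u x y z, u != x -> y != z -> y != u -> z != u ->
    segment (phi u) (phi x) `&` segment (phi y) (phi z) `<=` [set phi x]) ->
  exists S, obstacle_representation e N phi S.
Proof.
move=> e_sym eirr phi_inj dir no_triple cross.
have e_neq u w : e u w -> u != w by apply: contraTneq => ->; rewrite eirr.
pose drawing : set E :=
  \bigcup_(p in [set p : V * V | e p.1 p.2]) segment (phi p.1) (phi p.2).
exists [set [set x] | x in ~` drawing]; split=> //.
  by move=> _ [x _ <-]; exact: connected1.
have bigcupE : \bigcup_(O in [set [set x] | x in ~` drawing]) O = ~` drawing.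
  apply/seteqP; split=> [x [_ [y yD <-] ->]//|x xD].
  by exists [set x] => //; exists x.
move=> u w uw; rewrite bigcupE; split=> [uwE|].
  have [F FP Fuw] := dir u w uw.
  exists (fun t => phi u + t *: (phi w - phi u)).
    exact: segment_geodesic FP Fuw.
  split; rewrite ?scale0r ?addr0 ?scale1r ?[_ + (_ - _)]addrC ?subrK//.
  by apply/disjoints_subset => x; rewrite setCK => uwx; exists (u, w).
move=> [f [fc [F FP Fmon]] [f0 f1 /disjoints_subset]]; rewrite setCK => fdraw.
apply: contrapT => nuw.
(* The drawing splits into the star [A] of edges at [u] and the union [B] of edges avoiding [u]; the
   curve will be trapped in [A]. *)
pose A := \bigcup_(x in [set x | e u x]) segment (phi u) (phi x).
pose B := \bigcup_(p in [set p : V * V | [/\ e p.1 p.2, p.1 != u & p.2 != u]])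
  segment (phi p.1) (phi p.2).
have drawAB x : drawing x -> A x \/ B x.
  move=> [[y z] /= yz yzx].
  have [yu|yu] := eqVneq y u; first by left; exists z; rewrite -?yu.
  have [zu|zu] := eqVneq z u; last by right; exists (y, z).
  by left; exists y; [rewrite /= e_sym -zu|apply: segmentC; rewrite -zu].
pose C := f @` `[0, 1]%classic.
(* Visiting a third vertex would give two successive steps in the cone of the same facet. *)
have Cphi x : C (phi x) -> x = u \/ x = w.
  move=> [t /= /itvP t01 ft]; apply: contrapT => /not_orP[/eqP xu /eqP xw].
  apply: (no_triple u x w F) => //; first by rewrite eq_sym.
    by rewrite -ft -f0; apply/sectorE/Fmon; rewrite ?t01.
  by rewrite -ft -f1; apply/sectorE/Fmon; rewrite ?t01.
(* Here and for [phiA], [cross] is applied to the segment of the non-edge between [u] and [w]. *)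
have phiB : ~ B (phi u).
  move=> [[y z] [/= /e_neq yz yu zu] Bu].
  have /phi_inj : phi u = phi w.
    by apply: (cross u w y z) => //; split=> //; exact: segment_left.
  by move=> /eqP; rewrite (negbTE uw).
have phiA : ~ A (phi w).
  move=> [x /= ux Au].
  have xw : x != w by apply/eqP => xw; apply: nuw; rewrite -xw.
  have /phi_inj : phi w = phi u.
    apply: (cross w u u x) => //; rewrite 1?eq_sym//.
      by rewrite eq_sym e_neq.
    by split=> //; exact: segment_left.
  by move=> /eqP; rewrite eq_sym (negbTE uw).
(* A point of the curve in both [A] and [B] is [phi y] for a neighbour [y] of [u]; by [Cphi], [y] is
   [u] or [w], neither of which is a neighbour. *)
have AB : C `&` A `&` B = set0.
  rewrite -subset0 => x [[Cx [y /= uy yx]] [[y' z'] [/= /e_neq yz' yu' zu'] yx']].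
  have xE : x = phi y by apply: (cross u y y' z') => //; rewrite e_neq.
  move: Cx; rewrite xE => /Cphi[yE|yE].
    by move: uy; rewrite yE eirr.
  by apply: nuw; rewrite -yE.
have A_closed : closed A.
  by apply: closed_bigcup => [|x _]; [exact: finite_finset|exact: segment_closed].
have B_closed : closed B.
  by apply: closed_bigcup => [|x _]; [exact: finite_finset|exact: segment_closed].
have C0 : C (phi u) by exists 0; rewrite //= in_itv/= lexx ler01.
have C1 : C (phi w) by exists 1; rewrite //= in_itv/= lexx ler01.
(* In the connected image [C], the trace of [A] is closed, and also open as the complement of [B],
   so it is all of [C] and contains [phi w]. *)
have : C `&` A = C.
  apply: (connected_continuous_connected (@segment_connected R 0 1) fc).
  - by exists (phi u); split=> //; have [] := drawAB _ (fdraw _ C0).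
  - exists (~` B); first exact: closed_openC.
    apply/seteqP; split=> x [Cx Hx]; split=> //.
      by move=> Bx; have : set0 x by rewrite -AB.
    by have [] := drawAB _ (fdraw _ Cx).
  - by exists A.
by move=> CA; apply: phiA; move: C1; rewrite -CA => -[].
Qed.

End SegmentDrawing.

(** * Coding directions by facets *)

(** Greedy choice: keep the head and discard its partner, so each kept element uses up at most
    two. *)
Lemma involution_free_subseq (T : eqType) (g : T -> T) (s : seq T) :
  involutive g -> uniq s -> {in s, forall x, g x != x} ->
  exists s', [/\ {subset s' <= s}, uniq s', (size s <= 2 * size s')%N
               & {in s' &, forall x y, g x != y}].
Proof.
move=> gK; have [n] := ubnP (size s); elim: n s => // n IHn [|x s] /=.
  by exists [::].
rewrite ltnS => sn /andP[xs s_uniq] sg.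
have rs : (size s <= (size (rem (g x) s)).+1)%N.
  have [gs|gs] := boolP (g x \in s); last by rewrite rem_id.
  by rewrite size_rem// leqSpred.
have r_sub : {subset rem (g x) s <= s} by exact: mem_rem.
have [|||s' [s's s'_uniq s'_size s'g]] := IHn (rem (g x) s).
- by apply: leq_trans sn; rewrite ltnS uniq_leq_size ?rem_uniq.
- exact: rem_uniq.
- by move=> y /r_sub ys; apply: sg; rewrite inE ys orbT.
have s's' y : y \in s' -> y \in s by move=> /s's /r_sub.
have gx y : y \in s' -> g x != y.
  by move=> /s's; rewrite mem_rem_uniq// !inE eq_sym => /andP[].
exists (x :: s'); split=> /=.
- by move=> y; rewrite !inE => /predU1P[->|/s's' ->]; rewrite ?eqxx ?orbT.
- by rewrite s'_uniq andbT; apply: contra xs; exact: s's'.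
- by move: rs s'_size; lia.
- move=> y z; rewrite !inE => /predU1P[->|ys] /predU1P[->|zs].
  + by apply: sg; rewrite inE eqxx.
  + exact: gx.
  + by rewrite -(inj_eq (inv_inj gK)) gK eq_sym gx.
  + exact: s'g.
Qed.

Section Representation.
Context {R : realType} {d : nat}.
Local Notation E := 'rV[R]_d.

Definition opp_set (F : set E) : set E := [set x | F (- x)].

Lemma opp_setK : involutive opp_set.
Proof. by move=> F; apply/seteqP; split=> x; rewrite /opp_set /= opprK. Qed.

(** The normal takes the value [b > 0] on [F] and [- b] on its antipode. *)
Lemma facet_opp_neq (N : {fset E}) (F : set E) :
  facets (polyhedron N) F -> opp_set F != F.
Proof.
move=> /facet_normal[c [b [b0 _ FE [k _ [x [_ [Fx _ _ _]]]]]]].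
apply/eqP => FN; have : opp_set F (- x) by rewrite /opp_set /= opprK.
move: Fx; rewrite FN FE => -[_ /= cx] [_ /=]; rewrite dotvN cx => bN.
by move: b0; rewrite -bN oppr_gt0; lra.
Qed.

Lemma cone_opp (F : set E) (x : E) : x != 0 ->
  cone F (- x) -> cone (opp_set F) x.
Proof.
move=> x0 /coneP; rewrite oppr_eq0 => /(_ x0)[t t0 Fx]; apply/coneP => //.
by exists t; rewrite // /opp_set /= -scalerN.
Qed.

(** Keeping at most one facet of each antipodal pair costs the factor 2 in the bound on the number
    of facets. *)
Lemma opp_facets_free (N : {fset E}) (m : nat) :
  (`I_m #<= facets (polyhedron N))%card ->
  exists k (F : 'I_k -> set E),
    [/\ (m <= 2 * k)%N, forall i, facets (polyhedron N) (F i), injective F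
      & forall i j, opp_set (F i) != F j].
Proof.
move=> /pcard_leP[g].
have gI i : i \in iota 0 m -> i \in `I_m.
  by rewrite mem_iota /= add0n => im; rewrite inE.
pose s := map g (iota 0 m).
have sF x : x \in s -> facets (polyhedron N) x.
  by move=> /mapP[i /gI im ->]; apply: funS; rewrite inE in im.
have s_uniq : uniq s.
  rewrite map_inj_in_uniq ?iota_uniq// => i j /gI im /gI jm.
  exact: (@inj _ _ _ g).
have [s' [s's s'_uniq ss' s'g]] := involution_free_subseq opp_setK s_uniq
  (fun x xs => facet_opp_neq (sF x xs)).
exists (size s'), (tnth (in_tuple s')); split=> [|i|i j|i j].
- by rewrite -[m](size_iota 0) -(size_map g).
- by apply/sF/s's; exact: mem_tnth.
- rewrite !(tnth_nth set0) => /eqP.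
  by rewrite nth_uniq ?ltn_ord// => /eqP/val_inj.
- by apply: s'g; exact: mem_tnth.
Qed.

Lemma leq_exp2_log2 (n k : nat) :
  (0 < n)%N -> log2 (n%:R : R) <= k%:R -> (n <= 2 ^ k)%N.
Proof.
move=> n0; have ln2 : 0 < ln (2 : R) by rewrite ln_gt0// ltr1n.
rewrite /log2 ler_pdivrMr// mulr_natl -lnXn// ler_ln ?posrE ?ltr0n//.
  by rewrite -natrX ler_nat.
Qed.

Lemma binary_code (V : finType) (k : nat) : (#|V| <= 2 ^ k)%N ->
  exists code : V -> {ffun 'I_k -> bool}, injective code.
Proof.
rewrite -[(2 ^ k)%N](_ : #|{ffun 'I_k -> bool}| = _) => [Vk|]; last first.
  by rewrite card_ffun card_bool card_ord.
exists (fun v => enum_val (widen_ord Vk (enum_rank v))) => u v.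
by move=> /enum_val_inj /(congr1 val) /= /val_inj /enum_rank_inj.
Qed.

Lemma top_bit (k : nat) (a b : {ffun 'I_k -> bool}) : a != b ->
  exists i : 'I_k, a i != b i /\ forall j : 'I_k, (i < j)%N -> a j = b j.
Proof.
move=> ab; have [i0 abi0] : exists i, a i != b i.
  apply/existsP; apply: contraNT ab; rewrite negb_exists => /forallP ab.
  by apply/eqP/ffunP => i; apply/eqP; rewrite -[_ == _]negbK.
have [i abi imax] := @arg_maxnP _ i0 (fun i => a i != b i) val abi0.
exists i; split=> // j ij; apply/eqP; apply: contraTT ij => /imax.
by rewrite -leqNgt.
Qed.

Lemma near_implies (P : Prop) (Q : R -> Prop) :
  (P -> \forall s \near +oo, Q s) -> \forall s \near +oo, P -> Q s.
Proof.
move=> PQ; have [p|np] := pselect P; last by apply: nearW.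
by apply: filterS (PQ p).
Qed.

(** There are only finitely many families of vertices, so the thresholds on [s] can be combined;
    passing to [{ffun}] exposes this finiteness. *)
Lemma near_affine_free (V : finType) (phi : R -> V -> E) (q : nat) :
  (forall p : 'I_q.+1 -> V, injective p ->
    \forall s \near +oo, forall c : 'I_q.+1 -> R,
    \sum_i c i = 0 -> \sum_i c i *: phi s (p i) = 0 -> forall i, c i = 0) ->
  \forall s \near +oo, forall p : 'I_q.+1 -> V, injective p ->
    forall c : 'I_q.+1 -> R,
    \sum_i c i = 0 -> \sum_i c i *: phi s (p i) = 0 -> forall i, c i = 0.
Proof.
move=> H.
have : \forall s \near +oo, forall p : {ffun 'I_q.+1 -> V}, injective p ->
    forall c : 'I_q.+1 -> R,
    \sum_i c i = 0 -> \sum_i c i *: phi s (p i) = 0 -> forall i, c i = 0.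
  by apply: filter_forall => p; apply: near_implies; exact: H.
apply: filterS => s Hs p p_inj c c0 cp; apply: (Hs (finfun p)) => //.
  by move=> i j; rewrite !ffunE => /p_inj.
by under eq_bigr do rewrite ffunE.
Qed.

(** * Facets determined by coded directions *)

Section Coded.
Variables (N : {fset E}) (V : finType) (k : nat) (F : 'I_k -> set E)
  (code : V -> {ffun 'I_k -> bool}).
Hypotheses (FP : forall i, facets (polyhedron N) (F i)) (F_inj : injective F)
  (F_opp : forall i j, opp_set (F i) != F j) (code_inj : injective code).
Variable X : 'I_k -> d.-tuple E.
Hypotheses (Xfree : forall i, free (X i)) (XF : forall i j, F i (tnth (X i) j)).
Variable phi : V -> E.
Hypothesis phi_cone : forall (u w : V) (i : 'I_k),
  (forall j : 'I_k, (i < j)%N -> code u j = code w j) ->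
  code w i -> ~~ code u i -> simplicial_cone (X i) (phi w - phi u).

Definition signed_facet (b : bool) (i : 'I_k) : set E :=
  if b then F i else opp_set (F i).

Lemma signed_facet_facet b i : facets (polyhedron N) (signed_facet b i).
Proof. by case: b; [exact: FP|apply: facetN; exact: FP]. Qed.

Lemma signed_facet_inj b b' i i' :
  signed_facet b i = signed_facet b' i' -> b = b' /\ i = i'.
Proof.
case: b; case: b' => /= FE.
- by split=> //; apply: F_inj.
- by have := F_opp i' i; rewrite FE eqxx.
- by have := F_opp i i'; rewrite FE eqxx.
- by split=> //; apply/F_inj/(inv_inj opp_setK).
Qed.

Lemma phi_cone_facet (u w : V) (i : 'I_k) :
  (forall j : 'I_k, (i < j)%N -> code u j = code w j) ->
  code w i -> ~~ code u i ->
  [/\ phi w - phi u != 0, cone (F i) (phi w - phi u)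
    & forall G, facets (polyhedron N) G -> cone G (phi w - phi u) -> G = F i].
Proof.
move=> top wi ui; have pos := phi_cone top wi ui.
have x0 := simplicial_cone_neq0 (FP i) pos; split=> //.
  apply/coneP => //; eexists; last exact: simplicial_cone_facet pos.
  by rewrite invr_ge0 sumr_ge0// => j _; exact/ltW.
move=> G GP /(coneP _ x0)[t t0 Gx].
exact: (simplicial_cone_facet_eq (FP i) (Xfree i) (XF i) GP pos t0 Gx).
Qed.

Lemma code_direction (u w : V) : u != w -> exists i : 'I_k,
  [/\ code u i != code w i, phi w - phi u != 0,
      cone (signed_facet (code w i) i) (phi w - phi u)
    & forall G, facets (polyhedron N) G -> cone G (phi w - phi u) ->
        G = signed_facet (code w i) i].
Proof.
rewrite -(inj_eq code_inj) => /top_bit[i [uwi top]]; exists i.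
case: (boolP (code w i)) (uwi) => wi; rewrite ?eqb_id ?eqbF_neg ?negbK => ui.
  by have [] := phi_cone_facet top wi ui; split.
(* When the bit drops from [u] to [w], the reversed direction lies in the cone of [F i], and taking
   antipodes translates back. *)
have top' (j : 'I_k) (ij : (i < j)%N) := esym (top j ij).
have [x0 Fx Fx_uniq] := phi_cone_facet top' ui wi.
have x0' : phi w - phi u != 0 by rewrite -oppr_eq0 opprB.
split=> //; first by apply: cone_opp; rewrite ?opprB.
move=> G GP Gx; apply: (inv_inj opp_setK); rewrite opp_setK.
apply: Fx_uniq; first exact: facetN.
by apply: cone_opp; rewrite ?opprB.
Qed.

(** Each direction determines its signed facet, so both steps change the same bit to the same value;
    but after the first step the bit already has that value. *)
Lemma no_monotone_triple (u x w : V) (G : set E) :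
  u != x -> x != w -> facets (polyhedron N) G ->
  cone G (phi x - phi u) -> cone G (phi w - phi x) -> False.
Proof.
move=> /code_direction[i [uxi _ _ ux]] /code_direction[j [xwj _ _ xw]].
move=> GP /(ux _ GP) Gi /(xw _ GP) Gj.
have /signed_facet_inj[xwb ij] := etrans (esym Gi) Gj.
by move: xwj; rewrite -ij xwb -ij eqxx.
Qed.

End Coded.
End Representation.

Theorem theorem6 (R : realType) (d n : nat) (hd : (3 <= d)%N) (hn : (1 <= n)%N)
    (N : {fset 'rV[R]_d}) (m : nat)
    (hm : (`I_m #<= facets (polyhedron N))%card) (hlog : 2 * log2 (n%:R : R) <= m%:R)
    (V : finType) (e : rel V) (esym : symmetric e) (eirr : irreflexive e)
    (hV : #|V| = n) :
  exists (phi : V -> 'rV[R]_d) (S : set (set 'rV[R]_d)),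
    obstacle_representation e N phi S.
Proof.
have [k [F [mk FP F_inj F_opp]]] := opp_facets_free hm.
have /binary_code[code code_inj] : (#|V| <= 2 ^ k)%N.
  rewrite hV; apply: (@leq_exp2_log2 R) => //.
  rewrite -(ler_pM2l (ltr0n R 2)); apply: le_trans hlog _.
  by rewrite -natrM ler_nat.
have /choice[X XF] : forall i, exists X : d.-tuple 'rV[R]_d,
  free X /\ forall j, F i (tnth X j) by move=> i; exact: facet_basis (FP i).
(* All coordinates of this sum in the basis are 1, so it lies in the open cone over the simplex in
   facet [i]. *)
pose f i := \sum_(j < d) (X i)`_j.
have coordf i j : coord (X i) j (f i) = 1.
  rewrite -[f i](_ : \sum_(l < d) 1 *: (X i)`_l = _); last first.
    by apply: eq_bigr => l _; rewrite scale1r.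
  by rewrite coord_sum_free//; exact: (XF i).1.
have cone_near : \forall s \near +oo, forall (u w : V) (i : 'I_k) (l : 'I_d),
    (forall j : 'I_k, (i < j)%N -> code u j = code w j) ->
    code w i -> ~~ code u i ->
    0 < coord (X i) l (placement code f s w - placement code f s u).
  apply: filter_forall => u; apply: filter_forall => w.
  apply: filter_forall => i; apply: filter_forall => l.
  do 3!apply: near_implies => ?.
  apply: (@near_placement_gt0 _ _ _ _ _ _ (coord (X i) l) i) => //=.
  by rewrite coordf.
(* The range [q < 4] covers the at most four endpoints of two segments; [hd] ensures [q <= d]
   there. *)
have free_near : \forall s \near +oo, forall (q : 'I_4) (p : 'I_q.+1 -> V),
    injective p -> forall c : 'I_q.+1 -> R, \sum_i c i = 0 ->
    \sum_i c i *: placement code f s (p i) = 0 -> forall i, c i = 0.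
  apply: filter_forall => q; apply: near_affine_free => p p_inj.
  apply: near_placement_affine_free => //; apply: leq_trans hd.
  exact: ltn_ord q.
have [s [s_cone s_free]] := filter_ex (filterI cone_near free_near).
pose phi := placement code f s.
have phi_cone u w (i : 'I_k) :
    (forall j : 'I_k, (i < j)%N -> code u j = code w j) ->
    code w i -> ~~ code u i -> simplicial_cone (X i) (phi w - phi u).
  by move=> top wi ui l; exact: s_cone.
have Xfree i := (XF i).1; have XF2 i := (XF i).2.
have dir := code_direction FP code_inj Xfree XF2 phi_cone.
exists phi; apply: segment_obstacle_representation => //.
- move=> u w; have [//|/dir[i [_ + _ _]]] := eqVneq u w.
  by move=> + phi_uw; rewrite phi_uw subrr eqxx.
- move=> u w /dir[i [_ _ uw _]].
  by exists (signed_facet F (code w i) i) => //; exact: signed_facet_facet.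
- move=> u x w G.
  exact: (no_monotone_triple FP F_inj F_opp code_inj Xfree XF2 phi_cone).
apply: affine_free_segmentI => q p q3.
exact: (s_free (Ordinal (q3 : (q < 4)%N)) p).
Qed.
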